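(* (a) Let $M=2$ and $n\ge 1$. For any word $W\in\{0,1\}^n$ of length $n$, $$P(W\text{ is }M\text{-seen in }Y)\le v_n .$$ (b) Let $M\ge 2$ be an integer, let $p,q\ge 0$ be integers, and let $W_{p,q}=(1,1,\dots,1,0,0,\dots,0)$ be the word comprising $p$ $1$'s followed by $q$ $0$'s. Then $$P(W_{p,q}\text{ is }M\text{-seen in }Y)\le v_{p+q}.$$
   Context: $Y=(Y_1,Y_2,\dots)$ is an i.i.d. sequence of Bernoulli random variables with $P(Y_j=1)=P(Y_j=0)=\tfrac12$. Let $M$ be a positive integer. A word $W=(w_1,\dots,w_n)\in\{0,1\}^n$ is called $M$-seen in $Y$ if there are integers $m_1,\dots,m_n$ such that, with $m_0=0$, $1\le m_i-m_{i-1}\le M$ and $Y_{m_i}=w_i$ for all $1\le i\le n$ (the empty word is always $M$-seen). $A_n=(1,0,1,0,\dots)$ denotes the alternating word of length $n$ starting with $1$, and $v_n=P(A_n\text{ is }M\text{-seen in }Y)$ (with the same $M$ as in the statement), so $v_0=1$. *)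

(* Defs.v *)
From HB Require Import structures.
From mathcomp Require Import all_boot all_order all_algebra.
From mathcomp Require Import all_classical all_reals all_analysis.

Set Implicit Arguments.
Unset Strict Implicit.
Unset Printing Implicit Defensive.

Import Order.TTheory GRing.Theory Num.Theory.

Local Open Scope classical_set_scope.
Local Open Scope ring_scope.

(* A uniq sequence of indices stands for a finite subfamily. *)
Definition independent_rvs (d d' : measure_display) (T : measurableType d)
    (T' : measurableType d') (R : realType) (P : probability T R) (I : eqType)
    (D : set I) (X : I -> {RV P >-> T'}) : Prop :=
  forall (s : seq I) (B : I -> set T'),
    uniq s -> [set` s] `<=` D -> (forall i, measurable (B i)) ->
    (P (\bigcap_(i in [set` s]) (X i @^-1` B i))
     = \prod_(i <- s) P (X i @^-1` B i))%E.

(* The sequence is Y 1, Y 2, ...; nothing is assumed about Y 0, and it is never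
   read by M_seen. *)
Definition iid_fair_bits (d : measure_display) (T : measurableType d)
    (R : realType) (P : probability T R) (Y : nat -> {RV P >-> bool}) : Prop :=
  independent_rvs [set j | (0 < j)%N] Y /\
  forall (j : nat) (b : bool), (0 < j)%N -> P (Y j @^-1` [set b]) = (2^-1)%:E.

(* The letter w_i is nth false w i.-1, and only m 0, ..., m (size w) matter.
   Since m is increasing from 0, it loses nothing to take it nat-valued. *)
Definition M_seen (M : nat) (w : seq bool) (y : nat -> bool) : Prop :=
  exists m : nat -> nat, m 0%N = 0%N /\
    forall i : nat, (1 <= i <= size w)%N ->
      (m i.-1 + 1 <= m i <= m i.-1 + M)%N /\ y (m i) = nth false w i.-1.

Definition alternating_word (n : nat) : seq bool :=
  mkseq (fun i => ~~ odd i) n.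

Definition block_word (p q : nat) : seq bool := nseq p true ++ nseq q false.

(* The event depends on Y 1, ..., Y (M * size w) only, hence is measurable. *)
Definition prob_seen (d : measure_display) (T : measurableType d)
    (R : realType) (P : probability T R) (Y : nat -> {RV P >-> bool})
    (M : nat) (w : seq bool) : \bar R :=
  P [set t | M_seen M w (fun j => Y j t)].

Definition v (d : measure_display) (T : measurableType d)
    (R : realType) (P : probability T R) (Y : nat -> {RV P >-> bool})
    (M n : nat) : \bar R :=
  prob_seen Y M (alternating_word n).

(* Main.v *)
Require Import Defs.
From HB Require Import structures.
From mathcomp Require Import all_boot all_order all_algebra.
From mathcomp Require Import all_classical all_reals all_analysis.
From mathcomp Require Import zify ring lra.

(* Write f(w) for the probability that w is M-seen.

   (a) Let M = 2. For the word a w', the event "Y_1 = a and w' is seen from 1"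
   and its translate by one position have probability f(w')/2 each, and their
   union is the event that a w' is seen. If w' = b w'', their intersection
   contains "Y_1 = Y_2 = a, Y_3 = b and w'' is seen from 3", and equals it when
   a <> b. Hence f(a b w'') <= f(b w'') - f(w'')/8, with equality for the
   alternating word.

   (b) Put eps = 2^-M, theta = 1 - eps and rate = 1 - M eps^2 / theta. Following
   the two most advanced stages of the alternating word gives
   v_{n+1} >= theta rate^n. For W_{p,q} the greedy chain of ones, always jumping
   to the first one, gives f(W_{p,q}) <= theta^p. Moreover, if W_{p,q} is seen
   but the chain of zeros started at the end of the greedy chain dies, then the
   zeros can only restart after a run of M ones that begins after the end of the
   greedy chain and ends before (p + 1) M; a union bound over the start of that
   run gives f(W_{p,q}) <= theta^(p+q) + p theta^(p+q-2) eps (M - 2 + 2 eps) / 2.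
   One of the two bounds suffices, except when p = 1 and q >= 2 is at most about
   M / 2; there f(W_{1,q}) <= f(W_{1,2}), and W_{1,2} fails to be seen when, after
   the first one, at most one zero occurs up to the position 2 M. *)

Set Implicit Arguments.
Unset Strict Implicit.
Unset Printing Implicit Defensive.

Import Order.TTheory GRing.Theory Num.Theory.

(** * Events on bit streams that inspect finitely many bits *)

Section Events.

Implicit Types (y z : nat -> bool) (f g h : (nat -> bool) -> bool).
Implicit Types (a b : bool) (w : seq bool).

Definition tl y : nat -> bool := fun i => y i.+1.

Definition bcons b y : nat -> bool := fun i => if i is j.+1 then y j else b.

Definition depends_below k f :=
  forall y z, (forall i, i < k -> y i = z i) -> f y = f z.

Definition local f := exists k, depends_below k f.

Lemma local_cst c : local (fun=> c).
Proof. by exists 0. Qed.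

Lemma local_head a : local (fun y => y 0 == a).
Proof. by exists 1 => y z ->. Qed.

Lemma local_tl f : local f -> local (fun y => f (tl y)).
Proof.
by case=> k fk; exists k.+1 => y z yz; apply: fk => i ik; exact: yz.
Qed.

Lemma depends_below_bcons k f b :
  depends_below k.+1 f -> depends_below k (f \o bcons b).
Proof. by move=> fk y z yz; apply: fk => -[|i] //=; exact: yz. Qed.

Lemma depends_below_le k l f :
  k <= l -> depends_below k f -> depends_below l f.
Proof. by move=> kl fk y z yz; apply: fk => i /leq_trans/(_ kl)/yz. Qed.

Lemma local_bcons f b : local f -> local (f \o bcons b).
Proof.
by case=> k /(depends_below_le (leqnSn k)) fk; exists k; exact: depends_below_bcons.
Qed.

Lemma local_comp2 (op : bool -> bool -> bool) f g :
  local f -> local g -> local (fun y => op (f y) (g y)).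
Proof.
move=> [k fk] [l gl]; exists (maxn k l) => y z yz; congr op.
- by apply: (depends_below_le (leq_maxl k l) fk).
- by apply: (depends_below_le (leq_maxr k l) gl).
Qed.

Lemma local_if f g h : local f -> local g -> local h ->
  local (fun y => if f y then g y else h y).
Proof.
move=> lf lg lh; rewrite (_ : (fun y => _) =
    (fun y => (f y && g y) || (~~ f y && h y))); last first.
  by apply/funext => y; case: (f y); case: (g y).
apply: (local_comp2 orb); first exact: (local_comp2 andb).
by apply: (local_comp2 (fun u v => ~~ u && v)).
Qed.

(** A recursion on positions instead of an existential, so that conditioning on the first bit
    unfolds it. *)
Fixpoint win r a g y :=
  if r is r'.+1 then (y 0 == a) && g (tl y) || win r' a g (tl y) else false.

Fixpoint seen M w y := if w is a :: w' then win M a (seen M w') y else true.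

Lemma local_win r a g : local g -> local (win r a g).
Proof.
move=> lg; elim: r => [|r IH]; first exact: local_cst.
apply: (local_comp2 orb); last exact: local_tl.
by apply: (local_comp2 andb); [exact: local_head|exact: local_tl].
Qed.

Lemma local_seen M w : local (seen M w).
Proof.
by elim: w => [|a w IH]; [exact: local_cst|exact: local_win].
Qed.

Lemma winP r a g y :
  reflect (exists j, [/\ j < r, y j = a & g (fun i => y (j.+1 + i))])
          (win r a g y).
Proof.
elim: r y => [|r IH] y /=; first by apply: (iffP idP) => // -[j []].
apply: (iffP orP) => [[/andP[/eqP ya gy]|/IH[j [jr yj gj]]]|[[|j] [jr yj gj]]].
- by exists 0.
- by exists j.+1.
- by left; rewrite yj eqxx.
- by right; apply/IH; exists j.
Qed.

Lemma sub_win r s a g h y : r <= s -> (forall z, g z -> h z) ->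
  win r a g y -> win s a h y.
Proof.
move=> rs gh /winP[j [jr yj gj]]; apply/winP; exists j.
by split; [exact: leq_trans rs|..|exact: gh].
Qed.

Lemma seen_catl M w w' y : seen M (w ++ w') y -> seen M w y.
Proof.
elim: w y => [//|a w IH] y /=; exact: sub_win.
Qed.

(** Streams are read from index 0 by [seen] and from index 1 by [M_seen], hence [tl]. The induction
    on [w] needs an arbitrary last matched position [k]. *)
Lemma M_seenP M w y : M_seen M w y <-> seen M w (tl y).
Proof.
suff gen k : (exists m : nat -> nat, m 0 = k /\
    forall i, 1 <= i <= size w ->
      m i.-1 + 1 <= m i <= m i.-1 + M /\ y (m i) = nth false w i.-1) <->
    seen M w (fun i => y (k.+1 + i)) by exact: (gen 0).
elim: w k => [|a w IH] k /=.
  by split=> // _; exists (fun=> k); split => // -[|i] /andP[].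
split=> [[m [m0 hm]]|/winP[j [jM yj]]].
  have [/andP[lm mM] ym] := hm 1 isT.
  rewrite /= m0 in lm mM ym.
  apply/winP; exists (m 1 - k.+1); split; first by lia.
    by rewrite subnKC //; lia.
  have /IH : exists m' : nat -> nat, m' 0 = m 1 /\
      forall i, 1 <= i <= size w ->
      m' i.-1 + 1 <= m' i <= m' i.-1 + M /\ y (m' i) = nth false w i.-1.
    exists (fun i => m i.+1); split=> // -[//|i] /andP[_ ilt].
    exact: (hm i.+2).
  congr seen; apply/funext => i; congr y; lia.
rewrite (_ : (fun i => _) = (fun i => y ((k.+1 + j).+1 + i))); last first.
  by apply/funext => i; congr y; lia.
move=> /IH[m [m0 hm]]; exists (fun i => if i is i'.+1 then m i' else k).
split=> // -[//|[|i]] /=; first by rewrite m0 => _; split => //; lia.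
by rewrite ltnS => ilt; exact: (hm i.+1).
Qed.

End Events.

(** * Fair-coin probability of local events *)

Section Probability.
Variable R : realType.
Local Open Scope ring_scope.
Implicit Types (y z : nat -> bool) (f g h : (nat -> bool) -> bool).
Implicit Types (a b : bool) (w : seq bool).

(** The mean of [f] over all prefixes of length [k], each continued by [false]. *)
Fixpoint avg k f : R :=
  if k is k'.+1 then (avg k' (f \o bcons true) + avg k' (f \o bcons false)) / 2
  else (f (fun=> false))%:R.

Lemma avg_depends k l f : (k <= l)%N -> depends_below k f -> avg l f = avg k f.
Proof.
elim: k l f => [|k IH] [|l] f //= kl fk.
  rewrite (_ : f = fun=> f (fun=> false)); last first.
    by apply/funext => y; exact: fk.
  elim: l {kl} => [|l IHl] /=; first by lra.
  by move: IHl => /= IHl; rewrite !IHl; lra.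
by rewrite !(IH l) //; exact: depends_below_bcons.
Qed.

(** For a local [f], the depth picked by [get] is irrelevant, by [avg_depends]. *)
Definition Pr f : R := avg (get [set k | depends_below k f]) f.

Lemma PrE k f : depends_below k f -> Pr f = avg k f.
Proof.
move=> fk; rewrite /Pr; case: xgetP => [l _ /= fl|/(_ k)//].
by rewrite -(avg_depends (leq_maxl k l) fk) (avg_depends (leq_maxr k l) fl).
Qed.

(** At a depth common to both events this is pointwise inclusion-exclusion, and averaging is
    linear. *)
Lemma PrD f g : local f -> local g ->
  Pr f + Pr g = Pr (fun y => f y || g y) + Pr (fun y => f y && g y).
Proof.
move=> [k fk] [l gl]; have [m [fm gm]] : exists m, depends_below m f /\ depends_below m g.
  by exists (maxn k l); split; [apply: depends_below_le fk|apply: depends_below_le gl];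
    rewrite (leq_maxl, leq_maxr).
rewrite !(@PrE m) //; last 2 first.
- by move=> y z yz; rewrite (fm _ _ yz) (gm _ _ yz).
- by move=> y z yz; rewrite (fm _ _ yz) (gm _ _ yz).
elim: m f g {k l fk gl fm gm} => [|m IH] f g /=.
  by case: f; case: g; rewrite /=; lra.
have := IH (f \o bcons true) (g \o bcons true).
have := IH (f \o bcons false) (g \o bcons false).
rewrite /comp /=; lra.
Qed.

Lemma Pr_split a f : local f ->
  Pr f = (Pr (f \o bcons a) + Pr (f \o bcons (~~ a))) / 2.
Proof.
move=> [k /(depends_below_le (leqnSn k)) fk]; rewrite (PrE fk).
rewrite !(@PrE k); try exact: depends_below_bcons.
by case: a => //=; rewrite addrC.
Qed.

Lemma Pr_tl f : local f -> Pr (fun y => f (tl y)) = Pr f.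
Proof.
move=> lf; rewrite (Pr_split true); last exact: local_tl.
by rewrite (_ : _ \o _ = f) // (_ : _ \o _ = f) //; lra.
Qed.

Lemma Pr_true : Pr (fun=> true) = 1.
Proof. by rewrite (@PrE 0). Qed.

Lemma Pr_false : Pr (fun=> false) = 0.
Proof. by rewrite (@PrE 0). Qed.

Lemma Pr_ge0 f : local f -> 0 <= Pr f.
Proof.
move=> [k fk]; rewrite (PrE fk) {fk}; elim: k f => [|k IH] f /=; first exact: ler0n.
by rewrite divr_ge0 ?addr_ge0.
Qed.

Lemma Pr_le f g : local f -> local g -> (forall y, f y -> g y) -> Pr f <= Pr g.
Proof.
move=> lf lg fg.
have lgf : local (fun y => g y && ~~ f y) by apply: (local_comp2 (fun u v => u && ~~ v)).
have := PrD lf lgf.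
rewrite (_ : (fun y => _ || _) = g); last first.
  by apply/funext => y; have := fg y; case: (f y); case: (g y) => // /(_ isT).
rewrite (_ : (fun y => f y && _) = fun=> false); last first.
  by apply/funext => y; case: (f y); case: (g y).
have := Pr_ge0 lgf; rewrite Pr_false; lra.
Qed.

Lemma Pr_or_le f g : local f -> local g ->
  Pr (fun y => f y || g y) <= Pr f + Pr g.
Proof.
move=> lf lg; rewrite (PrD lf lg) lerDl.
by apply: Pr_ge0; exact: (local_comp2 andb).
Qed.

Lemma PrC f : local f -> Pr (fun y => ~~ f y) = 1 - Pr f.
Proof.
move=> lf; have := PrD lf (local_comp2 (fun u _ => ~~ u) lf lf).
rewrite (_ : (fun y => _ || _) = fun=> true); last first.
  by apply/funext => y; exact: orbN.
rewrite (_ : (fun y => _ && _) = fun=> false); last first.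
  by apply/funext => y; exact: andbN.
by rewrite Pr_true Pr_false; lra.
Qed.

Lemma Pr_head a g : local g -> Pr (fun y => (y 0%N == a) && g (tl y)) = Pr g / 2.
Proof.
move=> lg; rewrite (Pr_split a); last first.
  by apply: (local_comp2 andb); [exact: local_head|exact: local_tl].
rewrite (_ : _ \o bcons a = g); last by apply/funext => y /=; rewrite eqxx.
rewrite (_ : _ \o bcons (~~ a) = fun=> false) ?Pr_false ?addr0 //.
by apply/funext => y /=; case: a.
Qed.

End Probability.

(** * Transfer from the fair-coin model to the sequence [Y] *)

Section Bridge.
Variables (d : measure_display) (T : measurableType d) (R : realType).
Variables (P : probability T R) (Y : nat -> {RV P >-> bool}).
Hypothesis hY : iid_fair_bits Y.
Local Open Scope classical_set_scope.
Local Open Scope ring_scope.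

Definition cylinder (s : seq bool) : set T :=
  \bigcap_(i in [set` iota 1 (size s)]) (Y i @^-1` [set nth false s i.-1]).

Lemma measurable_bit i b : measurable (Y i @^-1` [set b]).
Proof. by rewrite -[X in measurable X]setTI; exact: measurable_funP. Qed.

Lemma measurable_cylinder s : measurable (cylinder s).
Proof.
by apply: fin_bigcap_measurable => // i _; exact: measurable_bit.
Qed.

Lemma cylinderP s t :
  cylinder s t <-> forall i, (i < size s)%N -> Y i.+1 t = nth false s i.
Proof.
split=> [h i il|h [|i]]; rewrite /mkset ?mem_iota //.
  by have := h i.+1; rewrite /mkset mem_iota /= add1n ltnS => /(_ il).
by rewrite add1n ltnS /= => il; exact: h.
Qed.

Lemma prob_cylinder s : P (cylinder s) = (2^-1 ^+ size s)%:E.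
Proof.
have [ind fair] := hY.
rewrite /cylinder (ind (iota 1 (size s)) (fun i => [set nth false s i.-1])).
- rewrite (eq_big_seq (fun=> (2^-1)%:E)); last first.
    by move=> i; rewrite mem_iota => /andP[i0 _]; exact: fair.
  by rewrite prodEFin big_const_seq count_predT size_iota iter_mulr_1.
- exact: iota_uniq.
- by move=> i /=; rewrite mem_iota => /andP[].
- by [].
Qed.

(** The fixed prefix [s] lets the induction on [k] peel off the next bit: the event is the disjoint
    union of its parts over the cylinders of [rcons s true] and [rcons s false]. *)
Lemma prob_local k f s : depends_below k f ->
  let A := cylinder s `&` [set t | f (fun j => Y (size s + j).+1 t)] in
  measurable A /\ P A = (2^-1 ^+ size s * avg R k f)%:E.
Proof.
elim: k f s => [|k IH] f s fk /=.
  have -> : [set t | f (fun j => Y (size s + j).+1 t)] =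
            if f (fun=> false) then setT else set0.
    apply/seteqP; split => t /=.
      by rewrite (fk _ (fun=> false)) // => ->.
    by case: ifP => // f0 _; rewrite (fk _ (fun=> false)).
  case: (f _); rewrite ?setIT ?setI0 ?mulr1 ?mulr0.
  - by split; [exact: measurable_cylinder|exact: prob_cylinder].
  - by rewrite measure0.
pose A b := cylinder (rcons s b) `&`
  [set t | (f \o bcons b) (fun j => Y (size (rcons s b) + j).+1 t)].
have cylE b : cylinder (rcons s b) = cylinder s `&` (Y (size s).+1 @^-1` [set b]).
  apply/seteqP; split => t.
    move=> /cylinderP; rewrite size_rcons => h; split.
      apply/cylinderP => i il; have := h i (ltnW il).
      by rewrite nth_rcons il.
    by have := h _ (ltnSn _); rewrite nth_rcons ltnn eqxx.
  move=> [/cylinderP h /= hb]; apply/cylinderP => i.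
  rewrite size_rcons nth_rcons ltnS; case: ltngtP => // [il _|-> _ //].
  exact: h.
have AE : cylinder s `&` [set t | f (fun j => Y (size s + j).+1 t)] =
          A true `|` A false.
  apply/seteqP; split => t.
    move=> [cs /= ft].
    have : A (Y (size s).+1 t) t.
      split; first by rewrite cylE.
      rewrite /= (_ : bcons _ _ = (fun j => Y (size s + j).+1 t)) //.
      by apply/funext => -[|j] /=; rewrite ?addn0 // size_rcons addSnnS.
    by case: (Y (size s).+1 t) => ?; [left|right].
  have bc b : Y (size s).+1 t = b ->
      bcons b (fun j => Y (size (rcons s b) + j).+1 t) = (fun j => Y (size s + j).+1 t).
    by move=> yb; apply/funext => -[|j] /=; rewrite ?addn0 // size_rcons addSnnS.
  by case=> -[]; rewrite cylE => -[cs /= yb]; rewrite bc.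
have dA b : measurable (A b) /\ P (A b) = (2^-1 ^+ (size s).+1 * avg R k (f \o bcons b))%:E.
  have [mA pA] := IH (f \o bcons b) (rcons s b) (depends_below_bcons b fk).
  by split=> //; rewrite -(size_rcons s b) -pA.
rewrite AE; split; first by apply: measurableU; apply: (dA _).1.
rewrite measureU; [|exact: (dA _).1|exact: (dA _).1|].
  transitivity (P (A true) + P (A false))%E; first by [].
  by rewrite !(dA _).2 -EFinD -mulrDr exprSr -mulrA [_^-1 * _]mulrC.
apply/seteqP; split => // t [[ct _] [cf _]].
by move: ct cf; rewrite !cylE => -[_ /= ->] [].
Qed.

Lemma prob_seenE M w : prob_seen Y M w = (Pr R (seen M w))%:E.
Proof.
have [k wk] := local_seen M w.
have [_] := prob_local [::] wk.
rewrite /= expr0 mul1r -(PrE _ wk) => <-; congr (P _).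
apply/seteqP; split => t /=.
  by move=> /M_seenP h; split => //; apply/cylinderP.
by move=> [_ h]; apply/M_seenP.
Qed.

End Bridge.

Ltac locality :=
  repeat match goal with
  | |- local (fun y => @?f y && @?g y) => refine (@local_comp2 andb f g _ _)
  | |- local (fun y => @?f y || @?g y) => refine (@local_comp2 orb f g _ _)
  | |- local (fun y => y 0 == ?a) => exact: (local_head a)
  | |- local (fun y => tl y 0 == ?a) =>
      exact: (local_tl (local_head a))
  | |- local (fun y => tl (tl y) 0 == ?a) =>
      exact: (local_tl (local_tl (local_head a)))
  | |- local (fun y => ?f (tl (tl (tl y)))) =>
      refine (@local_tl (fun y => f (tl (tl y))) _)
  | |- local (fun y => ?f (tl (tl y))) =>
      refine (@local_tl (fun y => f (tl y)) _)
  | |- local (fun y => ?f (tl y)) => refine (@local_tl f _)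
  | |- local (seen _ _) => exact: local_seen
  | |- local (win _ _ _) => apply: local_win
  | _ => assumption
  end.

(** * Part (a): window of length two *)

Section WindowTwo.
Variable R : realType.
Local Open Scope ring_scope.

Lemma Pr_win_split r a (g : (nat -> bool) -> bool) : local g ->
  Pr R (win r.+1 a g) =
  (Pr R (fun y => g y || win r a g y) + Pr R (win r a g)) / 2.
Proof.
move=> lg; rewrite (Pr_split _ a); last exact: local_win.
rewrite (_ : _ \o bcons a = fun y => g y || win r a g y); last first.
  by apply/funext => y /=; rewrite eqxx.
by rewrite (_ : _ \o bcons (~~ a) = win r a g) //; apply/funext => y; case: a.
Qed.

Lemma Pr_win_true r a : Pr R (win r a (fun=> true)) = 1 - 2^-1 ^+ r.
Proof.
elim: r => [|r IH]; first by rewrite Pr_false expr0 subrr.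
by rewrite Pr_win_split ?IH; [rewrite Pr_true exprS; field|exact: local_cst].
Qed.

Lemma seen2_cons a w y :
  seen 2 (a :: w) y =
  (y 0%N == a) && seen 2 w (tl y) || (tl y 0%N == a) && seen 2 w (tl (tl y)).
Proof. by rewrite /= orbF. Qed.

Lemma Pr_seen2_cons a w :
  Pr R (seen 2 (a :: w)) = Pr R (seen 2 w) -
  Pr R (fun y => ((y 0%N == a) && seen 2 w (tl y)) &&
                 ((tl y 0%N == a) && seen 2 w (tl (tl y)))).
Proof.
pose r y := (y 0%N == a) && seen 2 w (tl y).
have lr : local r.
  by apply: (local_comp2 andb); [exact: local_head|exact/local_tl/local_seen].
rewrite (_ : seen 2 (a :: w) = fun y => r y || r (tl y)); last first.
  by apply/funext => y; exact: seen2_cons.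
have := PrD R lr (local_tl lr).
by rewrite (Pr_tl _ lr) Pr_head; [lra|exact: local_seen].
Qed.

Lemma Pr_head3 a b c (g : (nat -> bool) -> bool) : local g ->
  Pr R (fun y => (y 0%N == a) && ((tl y 0%N == b) &&
    ((tl (tl y) 0%N == c) && g (tl (tl (tl y)))))) = Pr R g / 8.
Proof.
move=> lg.
have l1 : local (fun y => (y 0%N == c) && g (tl y)) by locality.
have l2 : local (fun y => (y 0%N == b) && ((tl y 0%N == c) && g (tl (tl y)))).
  locality.
have := Pr_head R a l2; have := Pr_head R b l1; have := Pr_head R c lg.
by rewrite /= => -> -> ->; field.
Qed.

Lemma Pr_seen2_le a b w :
  Pr R (seen 2 [:: a, b & w]) <= Pr R (seen 2 (b :: w)) - Pr R (seen 2 w) / 8.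
Proof.
rewrite Pr_seen2_cons lerB // -(Pr_head3 a a b (local_seen 2 w)).
apply: Pr_le => [||y]; [by locality..|].
by rewrite !seen2_cons => /and4P[-> -> -> ->]; rewrite /= orbT.
Qed.

(** When the second bit is [a], a letter [~~ a] sought in a window of two must be matched by the
    third bit; this turns the inclusion behind [Pr_seen2_le] into an equality. *)
Lemma Pr_seen2_alternate a w :
  Pr R (seen 2 [:: a, ~~ a & w]) =
  Pr R (seen 2 (~~ a :: w)) - Pr R (seen 2 w) / 8.
Proof.
rewrite Pr_seen2_cons -(Pr_head3 a a (~~ a) (local_seen 2 w)); congr (_ - Pr _ _).
apply/funext => y; rewrite !seen2_cons.
case: (y 0%N == a) => //=; case: (tl y 0%N =P a) => [->|_] /=; last by rewrite andbF.
rewrite (_ : a == ~~ a = false) /=; last by case: a.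
by case: (_ == _) => //=; rewrite ?andbF //; case: (seen 2 w _).
Qed.

(** The starting letter is a parameter because the recursion flips it; [altword true] is convertible
    to [alternating_word]. *)
Definition altword a n : seq bool := mkseq (fun i => a (+) odd i) n.

Lemma altwordS a n : altword a n.+1 = a :: altword (~~ a) n.
Proof.
rewrite /altword /mkseq /= addbF; congr cons.
by rewrite (iotaDl 1 0) -map_comp; apply: eq_map => i /=; rewrite addNb addbN.
Qed.

Lemma Pr_seen2_single a : Pr R (seen 2 [:: a]) = 3 / 4.
Proof. by rewrite (Pr_win_true 2 a : Pr R (seen 2 [:: a]) = _); field. Qed.

Lemma Pr_alternating2_rec a n :
  Pr R (seen 2 (altword a n.+2)) =
  Pr R (seen 2 (altword (~~ a) n.+1)) - Pr R (seen 2 (altword a n)) / 8.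
Proof. by rewrite !altwordS negbK Pr_seen2_alternate. Qed.

(** The recursion and its initial values are the same for both starting letters. *)
Lemma Pr_alternating2_sym a n :
  Pr R (seen 2 (altword a n)) = Pr R (seen 2 (altword true n)).
Proof.
elim/ltn_ind: n a => -[//|[|n]] IH a.
  by rewrite !altwordS !Pr_seen2_single.
rewrite !Pr_alternating2_rec (IH n.+1) // (IH n) //.
by rewrite (IH n.+1 _ (~~ true)).
Qed.

(** Strengthened by $v_n/2\le v_{n+1}$, which the recursion preserves: it gives
    $v_{n+2}=v_{n+1}-v_n/8\ge\frac34 v_{n+1}$. *)
Lemma Pr_alternating2_gt0 n : 0 < Pr R (seen 2 (altword true n)).
Proof.
suff : 0 < Pr R (seen 2 (altword true n)) /\
  Pr R (seen 2 (altword true n)) / 2 <= Pr R (seen 2 (altword true n.+1)).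
  by case.
elim: n => [|n [IH1 IH2]].
  by rewrite altwordS Pr_seen2_single /= Pr_true; lra.
by rewrite (Pr_alternating2_rec true n) Pr_alternating2_sym; lra.
Qed.

(* The inequality is propagated between ratios of consecutive probabilities,
   because the recursive bound is decreasing in the shorter word. *)
Lemma Pr_seen2_ratio a w :
  Pr R (seen 2 (a :: w)) * Pr R (seen 2 (altword true (size w))) <=
  Pr R (seen 2 (altword true (size w).+1)) * Pr R (seen 2 w).
Proof.
elim: w a => [|b w IH] a; first by rewrite altwordS !Pr_seen2_single /= mulrC.
have := Pr_seen2_le a b w; have := IH b.
rewrite [size (b :: w)]/= (Pr_alternating2_rec true) (Pr_alternating2_sym (~~ true)).
have := Pr_alternating2_gt0 (size w).+1.
move: (Pr _ _) (Pr _ _) (Pr _ _) (Pr _ _) (Pr _ _) => v1 x0 x1 x2 v0.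
(* The recursive bound times $v_{n+1}$, with [n = size w], has the subtracted term $f(w)v_{n+1}/8$,
   which is at least $f(bw)v_n/8$ by the induction hypothesis. *)
nra.
Qed.

(** Cancel $v_n$ in $f(aw)v_n\le v_{n+1}f(w)\le v_{n+1}v_n$, with [n = size w]. *)
Lemma Pr_seen2_max w :
  Pr R (seen 2 w) <= Pr R (seen 2 (altword true (size w))).
Proof.
elim: w => [|a w IH] //.
have v0 := Pr_alternating2_gt0 (size w).
have v1 := Pr_alternating2_gt0 (size w).+1.
rewrite -(ler_pM2r v0); apply: le_trans (Pr_seen2_ratio a w) _.
by rewrite ler_pM2l.
Qed.

End WindowTwo.

(** * Lower bound for the alternating word, for general [M] *)

Section Alternating.
Variables (R : realType) (M : nat).
Hypothesis M2 : (2 <= M)%N.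
Local Open Scope ring_scope.

(** The probability that a window of [M] fair bits misses a given letter. Below, [rate] is chosen so
    that [theta * rate = 1 - eps - M * eps ^ 2], the factor that the induction for
    [Pr_alternating_ge] produces. *)
Definition eps : R := 2^-1 ^+ M.
Definition theta : R := 1 - eps.
Definition rate : R := 1 - M%:R * eps ^+ 2 / theta.

Lemma eps_gt0 : 0 < eps.
Proof. by rewrite exprn_gt0 // invr_gt0. Qed.

Lemma eps_nat : eps * (2 ^ M)%:R = 1.
Proof. by rewrite natrX -exprMn mulVf ?expr1n. Qed.

Lemma eps_le k : (k <= 2 ^ M)%N -> k%:R * eps <= 1.
Proof.
by move=> kM; rewrite -[leRHS]eps_nat mulrC ler_pM2l ?eps_gt0 // ler_nat. Qed.

Lemma theta_gt0 : 0 < theta.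
Proof.
have := @eps_le 2; have -> : (2 <= 2 ^ M)%N by rewrite -{1}(expn1 2) leq_exp2l //; lia.
by rewrite /theta => /(_ isT); have := eps_gt0; lra.
Qed.

Lemma theta_rate : theta * rate = theta - M%:R * eps ^+ 2.
Proof. by rewrite /rate; field; rewrite gt_eqF ?theta_gt0. Qed.

(** After multiplication by [theta] this is [(M + 1) * eps <= 1], that is, $M+1\le 2^M$. *)
Lemma theta_le_rate : theta <= rate.
Proof.
have e0 := eps_gt0; have t0 := theta_gt0.
rewrite -(ler_pM2l t0) theta_rate.
have : M.+1%:R * eps <= 1 by apply: eps_le; exact: ltn_expl.
rewrite -natr1 => Me; have : 0 <= eps * (1 - M%:R * eps - eps).
  by apply: mulr_ge0; lra.
by rewrite /theta; nra.
Qed.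

Lemma rate_ge0 : 0 <= rate.
Proof. exact: le_trans (ltW theta_gt0) theta_le_rate. Qed.

Lemma rate_le : rate <= 1 - 2 * eps ^+ 2.
Proof.
have e0 := eps_gt0; have t0 := theta_gt0.
rewrite -(ler_pM2l t0) theta_rate mulrBr mulr1 lerB //.
have M2' : 2 <= M%:R :> R by rewrite (ler_nat _ 2).
have := exprn_gt0 2 e0; rewrite /theta; nra.
Qed.

(* The last letter of [altword b n] to be matched has just been matched,
   and the previous stage still has [k] places at which to match that letter
   once more. *)
Definition ahead k b n y :=
  seen M (altword b n) y || win k (~~ b) (seen M (altword b n)) y.

Lemma local_ahead k b n : local (ahead k b n).
Proof.
by apply: (local_comp2 orb); [exact: local_seen|exact/local_win/local_seen].
Qed.

(** Condition on the next bit. If it is [b], the leading stage advances and may rematch this [b] at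
    [M - 1] further places. Otherwise the older stage rematches the last letter here, or at one of
    its [k] remaining places. *)
Lemma Pr_ahead_ge k b n :
  (Pr R (ahead M.-1 (~~ b) n) + Pr R (ahead k b n.+1)) / 2 <=
  Pr R (ahead k.+1 b n.+1).
Proof.
have M0 : M = M.-1.+1 by lia.
rewrite [leRHS](Pr_split _ b); last exact: local_ahead.
rewrite ler_pM2r ?invr_gt0 //; apply: lerD.
  apply: Pr_le => [||y]; [exact: local_ahead|exact/local_bcons/local_ahead|].
  rewrite /ahead negbK => h; apply/orP; left; rewrite altwordS.
  suff : win M.-1.+1 b (seen M (altword (~~ b) n)) (bcons b y) by rewrite -M0.
  by rewrite /= eqxx.
apply: Pr_le => [||y]; [exact: local_ahead|exact/local_bcons/local_ahead|].
by rewrite /ahead /= eqxx => h; rewrite h orbT.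
Qed.

(** Proved jointly with a bound for [ahead M.-1], since the step for each uses both. *)
Lemma Pr_alternating_ge b n : theta * rate ^+ n <= Pr R (seen M (altword b n.+1)).
Proof.
suff : (forall b, rate ^+ n <= Pr R (ahead M.-1 b n)) /\
       (forall b, theta * rate ^+ n <= Pr R (seen M (altword b n.+1))).
  by case.
elim: n {b} => [|n [IHa IHs]].
  split=> b; first by rewrite (_ : ahead _ _ _ = fun=> true) // Pr_true.
  by rewrite altwordS (Pr_win_true R M b : Pr R (seen M [:: b]) = _) expr0 mulr1.
have r0 : 0 <= rate ^+ n by rewrite exprn_ge0 ?rate_ge0.
(* Without a spare place the factor is [theta = 1 - eps]; each spare place halves the deficit. *)
have ha k b : (1 - 2^-1 ^+ k * eps) * rate ^+ n <= Pr R (ahead k b n.+1).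
  elim: k b => [|k IH] b.
    rewrite expr0 mul1r; apply: le_trans (IHs b) _.
    apply: Pr_le => [||y]; [exact: local_seen|exact: local_ahead|].
    by rewrite /ahead => ->.
  apply: le_trans (Pr_ahead_ge k b n).
  by have := IHa (~~ b); have := IH b; rewrite exprS; lra.
(* At [r = M] the factor is [theta * rate]. *)
have hs r b : (1 - 2^-1 ^+ r - r%:R * 2^-1 ^+ r * eps) * rate ^+ n <=
    Pr R (win r b (seen M (altword (~~ b) n.+1))).
  elim: r => [|r IH]; first by rewrite Pr_false expr0 subrr !mul0r subrr mul0r.
  rewrite Pr_win_split; last exact: local_seen.
  have := ha r (~~ b); rewrite /ahead negbK exprS -(natr1 r). lra.
split=> b.
  (* At [k = M - 1] the factor is [1 - 2 * eps ^ 2], whence [rate_le]. *)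
  apply: le_trans (ha _ _); rewrite exprS ler_wpM2r //.
  apply: le_trans rate_le _; have epsE : 2^-1 ^+ M.-1 = 2 * eps.
    by rewrite /eps -[in RHS](prednK (ltnW M2)) exprS mulrA mulfV ?mul1r.
  by rewrite epsE expr2 mulrA.
rewrite altwordS; apply: le_trans (hs M b).
by rewrite exprS mulrA theta_rate; rewrite /theta /eps expr2; lra.
Qed.

End Alternating.

(** * Greedy chains, and restarts of a constant word across gaps *)

Section Blocks.
Implicit Types (y z : nat -> bool) (g : (nat -> bool) -> bool).
Implicit Types (G h : nat -> (nat -> bool) -> bool) (a b : bool) (w : seq bool).

(* [N] bounds the number of positions that may still be inspected. *)
Fixpoint first_in r a G N y :=
  match r, N with
  | r'.+1, N'.+1 =>
      if y 0 == a then G N' (tl y) else first_in r' a G N' (tl y)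
  | _, _ => false
  end.

(** The continuation [h] receives the unspent budget, so that a later union bound counts only
    positions after the greedy chain. *)
Fixpoint greedy M a p h : nat -> (nat -> bool) -> bool :=
  if p is p'.+1 then first_in M a (greedy M a p' h) else h.

Lemma local_first_in r a G N :
  (forall n, local (G n)) -> local (first_in r a G N).
Proof.
move=> lG; elim: r N => [|r IH] [|N]; try exact: local_cst.
by apply: local_if; [exact: local_head|exact: local_tl..].
Qed.

Lemma local_greedy M a p h N :
  (forall n, local (h n)) -> local (greedy M a p h N).
Proof. by move=> lh; elim: p N => [|p IH] N //=; exact: local_first_in. Qed.

(* The greedy chain is never ahead of the chain witnessing that the word is
   seen, so that it survives as long as the latter does. *)
Lemma first_in_greedy M a w h p k l L N y :
  (forall n z, seen M w z -> h n z) ->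
  (forall j r n z, r + j * M <= n ->
     win r a (seen M (nseq j a ++ w)) z -> h n z) ->
  p <= k -> l <= L -> L <= M -> l + k * M <= N ->
  win l a (seen M (nseq k a ++ w)) y -> first_in L a (greedy M a p h) N y.
Proof.
move=> h0 h1; elim: N p k l L y => [|N IH] p k [|l] [|L] y //= pk lL LM kN.
case: eqP => [ya|_] /= => [/orP[|later]|]; last by apply: IH => //; lia.
- case: k pk kN => [|k] pk kN sk.
    by move: pk; rewrite leqn0 => /eqP ->; exact: h0.
  case: p pk => [|p] pk; first by apply: (h1 k M) sk; lia.
  by apply: IH sk => //; lia.
- case: p pk => [|p] pk; first by apply: h1 later; lia.
  by apply: IH later; lia.
Qed.

Lemma seen_greedy M a w h p N y :
  (forall n z, seen M w z -> h n z) ->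
  (forall j r n z, r + j * M <= n ->
     win r a (seen M (nseq j a ++ w)) z -> h n z) ->
  p * M <= N -> seen M (nseq p a ++ w) y -> greedy M a p h N y.
Proof.
case: p => [|p] h0 h1 pN /=; first exact: h0.
by apply: (first_in_greedy h0 h1) => //; lia.
Qed.

Fixpoint gap m b g y :=
  if m is m'.+1 then (y 0 == ~~ b) && gap m' b g (tl y)
  else (y 0 == b) && g (tl y).

Fixpoint any_gap M b g N y :=
  if N is N'.+1 then gap M b g y || any_gap M b g N' (tl y) else false.

Lemma local_gap m b g : local g -> local (gap m b g).
Proof.
move=> lg; elim: m => [|m IH];
  by apply: (local_comp2 andb); [exact: local_head|exact: local_tl].
Qed.

Lemma local_any_gap M b g N : local g -> local (any_gap M b g N).
Proof.
move=> lg; elim: N => [|N IH]; first exact: local_cst.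
by apply: (local_comp2 orb); [exact: local_gap|exact: local_tl].
Qed.

(** The wider window matters only if its first [b] is in its last place. An earlier [b] can start
    the chain instead: the old first match becomes the second, and the last letter is dropped by
    [seen_catl]. *)
Lemma win_constS M b q m y : m < M ->
  win m.+1 b (seen M (nseq q b)) y ->
  win m b (seen M (nseq q b)) y || gap m b (seen M (nseq q b)) y.
Proof.
elim: m y => [|m IH] y mM; first by rewrite /= orbF.
rewrite [win m.+2 _ _ _]/= [win m.+1 _ _ y]/= [gap m.+1 _ _ _]/=.
case: eqP => [yb|/eqP yb] /= h.
  suff -> : seen M (nseq q b) (tl y) by [].
  case/orP: h => [//|h].
  case: q h {IH} => [//|q]; rewrite -/(win m.+1 b _ _) => h.
  apply: (@sub_win m.+1 M b (seen M (nseq q.+1 b)) _ _ (ltnW mM)) h => z.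
  by rewrite -[q.+1]addn1 nseqD; exact: seen_catl.
rewrite (_ : y 0 == ~~ b); last by move: (b) (y 0) yb => [] [].
by apply: IH; [exact: ltnW|].
Qed.

(* Shifting the start of a constant word to the right can only help by jumping
   over a run of [M] wrong letters. *)
Lemma seen_const_tl M b q y : 0 < M -> seen M (nseq q.+1 b) (tl y) ->
  seen M (nseq q.+1 b) y || gap M b (seen M (nseq q b)) y.
Proof.
case: M => // m _ h.
have /orP[h'|h'] := @win_constS m.+1 b q m (tl y) (ltnSn m) h.
  by rewrite [seen _ _ _]/= h' orbT.
rewrite [seen _ _ _]/= [gap _ _ _ _]/= h' andbT.
case: eqP => [yb|/eqP yb]; last first.
  by rewrite (_ : y 0 == ~~ b) ?orbT //; move: (b) (y 0) yb => [] [].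
rewrite (_ : seen m.+1 (nseq q b) (tl y)) //.
by move: h; rewrite -[q.+1]addn1 nseqD; exact: seen_catl.
Qed.

(** The witnessing chain starts its final block within [r + j * M] positions. That start is moved
    back to the present one position at a time by [seen_const_tl], any failure exhibiting a gap. *)
Lemma seen_const_shift M a b q j r n y : 0 < M -> r + j * M <= n ->
  win r a (seen M (nseq j a ++ nseq q.+1 b)) y ->
  seen M (nseq q.+1 b) y || any_gap M b (seen M (nseq q b)) n y.
Proof.
move=> M0; elim: n j r y => [|n IH] j [|r] y // jn h.
have : seen M (nseq q.+1 b) (tl y) || any_gap M b (seen M (nseq q b)) n (tl y).
  case/orP: h => [/andP[_]|/IH]; last by apply; lia.
  case: j jn => [|j] jn; first by move=> ->.
  by move=> h; apply: (IH j M) h; lia.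
case/orP => [/(seen_const_tl M0)/orP[->//|g]|g].
  by rewrite [any_gap _ _ _ _ _]/= g orbT.
by rewrite [any_gap _ _ _ _ _]/= g !orbT.
Qed.

End Blocks.

(** * Upper bounds for block words *)

Section BlockProbability.
Variables (R : realType) (M : nat).
Local Open Scope ring_scope.
Local Notation eps := (eps R M).
Local Notation theta := (theta R M).
Implicit Types (g : (nat -> bool) -> bool) (h : nat -> (nat -> bool) -> bool).

(** Bounds affine in the budget are stable under a greedy jump. The subtracted factor
    [2 - (r + 2) / 2 ^ r] is $\sum_{i=1}^r i2^{-i}$, the mean budget spent on a successful jump. *)
Lemma Pr_first_in r a h (A B : R) (N0 N : nat) :
  (forall n, local (h n)) ->
  (forall n, (N0 <= n)%N -> Pr R (h n) <= A + B * n%:R) ->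
  (r + N0 <= N)%N ->
  Pr R (first_in r a h N) <=
  (1 - 2^-1 ^+ r) * (A + B * N%:R) - B * (2 - r.+2%:R * 2^-1 ^+ r).
Proof.
move=> lh hP; elim: r N => [|r IH] [|N] // rN.
- by rewrite Pr_false !expr0; lra.
- by rewrite Pr_false !expr0; lra.
rewrite (Pr_split _ a); last exact: local_first_in.
rewrite (_ : _ \o bcons a = h N); last by apply/funext => y /=; rewrite eqxx.
rewrite (_ : _ \o bcons (~~ a) = first_in r a h N); last first.
  by apply/funext => y /=; rewrite (_ : ~~ a == a = false) //; case: (a).
have := IH N rN; have := hP N ltac:(lia).
by rewrite exprS -(natr1 N) -(natr1 r.+2) -(natr1 r.+1) -(natr1 r); nra.
Qed.

Lemma Pr_greedy a p h (A B : R) N :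
  (forall n, local (h n)) -> (forall n, Pr R (h n) <= A + B * n%:R) ->
  (p * M <= N)%N ->
  Pr R (greedy M a p h N) <= theta ^+ p * (A + B * N%:R) -
    p%:R * theta ^+ p.-1 * B * (2 - M.+2%:R * eps).
Proof.
move=> lh hP; elim: p N => [|p IH] N pN.
  by rewrite expr0 mul1r !mul0r subr0; exact: hP.
have lg n : local (greedy M a p h n) by exact: local_greedy.
apply: le_trans (@Pr_first_in M a _
  (theta ^+ p * A - p%:R * theta ^+ p.-1 * B * (2 - M.+2%:R * eps))
  (theta ^+ p * B) (p * M) N lg _ _) _; last first.
- rewrite -/eps -/theta -(natr1 p) exprS [p.+1.-1]/=.
  by case: p {IH pN lg} => [|p] /=; rewrite ?mul0r ?exprS; nra.
- by rewrite mulSn in pN.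
- by move=> n /IH; rewrite mulrDr; lra.
Qed.

Lemma Pr_gap m b g : local g -> Pr R (gap m b g) = 2^-1 ^+ m.+1 * Pr R g.
Proof.
move=> lg; elim: m => [|m IH]; first by rewrite Pr_head // expr1 mulrC.
by rewrite Pr_head ?IH; [rewrite [in RHS]exprS; field|exact: local_gap].
Qed.

Lemma Pr_any_gap b g N : local g ->
  Pr R (any_gap M b g N) <= eps / 2 * Pr R g * N%:R.
Proof.
move=> lg; elim: N => [|N IH]; first by rewrite Pr_false mulr0.
apply: le_trans (Pr_or_le _ (local_gap M b lg) _) _.
  exact/local_tl/local_any_gap.
rewrite (Pr_tl R (local_any_gap M b N lg)) Pr_gap // exprS -(natr1 N) -/eps.
by lra.
Qed.

(** With a trivial continuation, the greedy chain only has to survive [p] windows. *)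
Lemma Pr_const_prefix_le a p w : Pr R (seen M (nseq p a ++ w)) <= theta ^+ p.
Proof.
pose h (_ : nat) (_ : nat -> bool) := true.
have l1 n : local (h n) by exact: local_cst.
apply: le_trans (@Pr_le R _ _ (local_seen _ _) (local_greedy M a p (p * M) l1) _) _.
  by move=> y; apply: seen_greedy.
apply: le_trans (@Pr_greedy a p h 1 0 (p * M) l1 _ (leqnn _)) _.
  by move=> n; rewrite Pr_true mul0r addr0.
by rewrite mul0r addr0 mulr1 mulr0 mul0r subr0.
Qed.

Lemma Pr_block_le a b p q : (0 < M)%N ->
  Pr R (seen M (nseq p a ++ nseq q.+1 b)) <=
  theta ^+ (p + q.+1) +
  p%:R * theta ^+ (p.-1 + q) * (eps * (M%:R - 2 + 2 * eps) / 2).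
Proof.
move=> M0; set h := fun n y =>
  seen M (nseq q.+1 b) y || any_gap M b (seen M (nseq q b)) n y.
have lh n : local (h n).
  by apply: (local_comp2 orb);
    [exact: local_seen|exact/local_any_gap/local_seen].
have t0 : 0 <= theta.
  by rewrite subr_ge0 exprn_ile1 // ?invr_ge0 // invf_le1 // ler1n.
apply: le_trans (@Pr_le R _ _ (local_seen _ _) (local_greedy M a p (p * M) lh) _) _.
- move=> y; apply: seen_greedy => //.
    by move=> n z; rewrite /h => ->.
  by move=> j r n z; exact: seen_const_shift.
apply: le_trans (@Pr_greedy a p h (theta ^+ q.+1) (eps / 2 * theta ^+ q)
  (p * M) lh _ (leqnn _)) _.
  move=> n; apply: le_trans (Pr_or_le _ _ _) _; [exact: local_seen|exact/local_any_gap/local_seen|].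
  apply: lerD; first by have := Pr_const_prefix_le b q.+1 [::]; rewrite cats0.
  apply: le_trans (Pr_any_gap _ _ (local_seen _ _)) _.
  rewrite ler_wpM2r // ler_wpM2l //; first by rewrite divr_ge0 ?exprn_ge0.
  by have := Pr_const_prefix_le b q [::]; rewrite cats0.
(* The last factor arises as [theta * M - (2 - (M + 2) * eps) = M - 2 + 2 * eps]: the whole budget
   minus what the jumps spend. *)
rewrite natrM !exprD -(natr1 M.+1) -(natr1 M) /theta.
case: p => [|p] /=; first by rewrite !mul0r expr0; lra.
by rewrite exprS; lra.
Qed.

End BlockProbability.

(** * One letter followed by two opposite ones *)

Section OneBlock.
Implicit Types (y : nat -> bool) (a b : bool).

Fixpoint run a k y := if k is k'.+1 then (y 0 == a) && run a k' (tl y) else true.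

(** Among [m + M] letters, at most one differs from [a], and only among the first [m]: an exception
    further on could still be followed by a second one within its window. *)
Fixpoint almost_run M a m y :=
  if m is m'.+1 then
    if y 0 == a then almost_run M a m' (tl y) else run a (m' + M) (tl y)
  else run a M y.

(** True when no [a] occurs in time, because the word then fails at its first letter. *)
Fixpoint late_almost_run M a m y :=
  if m is m'.+1 then
    if y 0 == a then almost_run M a m' (tl y) else late_almost_run M a m' (tl y)
  else true.

Lemma local_run a k : local (run a k).
Proof.
elim: k => [|k IH]; first exact: local_cst.
by apply: (local_comp2 andb); [exact: local_head|exact: local_tl].
Qed.

Lemma local_almost_run M a m : local (almost_run M a m).
Proof.
elim: m => [|m IH]; first exact: local_run.
apply: local_if; [exact: local_head|exact: local_tl|].
exact/local_tl/local_run.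
Qed.

Lemma local_late_almost_run M a m : local (late_almost_run M a m).
Proof.
elim: m => [|m IH]; first exact: local_cst.
apply: local_if; [exact: local_head| |exact: local_tl].
exact/local_tl/local_almost_run.
Qed.

Lemma run_win a k l g y : l <= k -> run a k y -> win l (~~ a) g y = false.
Proof.
elim: l k y => [|l IH] [|k] y //= lk /andP[/eqP -> /(IH _ _ lk) ->].
by rewrite orbF; case: (a).
Qed.

Lemma run_win_switch M a m w y : run a (m + M) y ->
  win m a (seen M (~~ a :: w)) y = false.
Proof.
elim: m y => [|m IH] y //= /andP[_ r]; rewrite (IH _ r) orbF.
by rewrite (run_win _ _ r) ?leq_addl // andbF.
Qed.

Lemma almost_run_win M a m l y : l <= M -> almost_run M a m y ->
  win l (~~ a) (seen M [:: ~~ a]) y = false.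
Proof.
elim: m l y => [|m IH] [|l] y lM //; first exact: run_win.
rewrite [almost_run _ _ _ _]/= [win _ _ _ _]/=.
case: eqP => [->|_] h.
  by rewrite (IH _ _ (ltnW lM) h) orbF; case: (a).
rewrite (run_win _ _ h) ?leq_addl // andbF /=.
by apply: run_win h; rewrite (leq_trans (ltnW lM)) ?leq_addl.
Qed.

Lemma almost_run_win_switch M a m y : almost_run M a m y ->
  win m a (seen M [:: ~~ a; ~~ a]) y = false.
Proof.
elim: m y => [|m IH] y //.
rewrite [almost_run _ _ _ _]/= [win _ _ _ _]/=.
case: eqP => [_|_] h /=; last exact: (@run_win_switch M a m [:: ~~ a] (tl y) h).
by rewrite (IH _ h) orbF; apply: almost_run_win h.
Qed.

(** Wherever [a] is matched, the first [~~ a] can only be the exception, and the window after it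
    contains only [a]. *)
Lemma late_almost_run_win M a m y : late_almost_run M a m y ->
  win m a (seen M [:: ~~ a; ~~ a]) y = false.
Proof.
elim: m y => [|m IH] y //.
rewrite [late_almost_run _ _ _ _]/= [win _ _ _ _]/=.
case: eqP => [_|_] h /=; last exact: IH.
by rewrite (almost_run_win_switch h) orbF; apply: almost_run_win h.
Qed.

Variable R : realType.
Local Open Scope ring_scope.

Lemma Pr_if a (g h : (nat -> bool) -> bool) : local g -> local h ->
  Pr R (fun y => if y 0%N == a then g (tl y) else h (tl y)) =
  (Pr R g + Pr R h) / 2.
Proof.
move=> lg lh; rewrite (Pr_split _ a); last first.
  by apply: local_if; [exact: local_head|exact: local_tl..].
rewrite (_ : _ \o bcons a = g); last by apply/funext => y /=; rewrite eqxx.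
rewrite (_ : _ \o bcons (~~ a) = h) //.
by apply/funext => y /=; case: a.
Qed.

Lemma Pr_run a k : Pr R (run a k) = 2^-1 ^+ k.
Proof.
elim: k => [|k IH]; first exact: Pr_true.
by rewrite Pr_head ?IH ?exprSr //; exact: local_run.
Qed.

Lemma Pr_almost_run M a m :
  Pr R (almost_run M a m) = m.+1%:R * 2^-1 ^+ (m + M).
Proof.
elim: m => [|m IH]; first by rewrite Pr_run mul1r.
rewrite Pr_if ?IH ?Pr_run; [|exact: local_almost_run|exact: local_run].
by rewrite addSn exprS -(natr1 m.+1) -(natr1 m); field.
Qed.

(** The first term is the absence of [a]; the second sums [Pr_almost_run] over the position of the
    first [a]. *)
Lemma Pr_late_almost_run M a m :
  Pr R (late_almost_run M a m) =
  2^-1 ^+ m + m%:R * m.+1%:R / 2 * 2^-1 ^+ (m + M).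
Proof.
elim: m => [|m IH]; first by rewrite Pr_true expr0 !mul0r addr0.
rewrite Pr_if ?IH ?Pr_almost_run;
  [|exact: local_almost_run|exact: local_late_almost_run].
by rewrite addSn !exprS -(natr1 m.+1) -(natr1 m); field.
Qed.

Lemma Pr_switch_twice_le M a :
  Pr R (seen M [:: a; ~~ a; ~~ a]) <=
  1 - eps R M - M%:R * M.+1%:R / 2 * eps R M ^+ 2.
Proof.
have ll := local_late_almost_run M a M.
apply: (@le_trans _ _ (Pr R (fun y => ~~ late_almost_run M a M y))).
  apply: Pr_le => [||y]; first exact: local_seen.
    by apply: (local_comp2 (fun u _ => ~~ u) ll ll).
  by apply: contraTN => /late_almost_run_win h; rewrite [seen _ _ _]h.
by rewrite PrC // Pr_late_almost_run exprD expr2 /eps; lra.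
Qed.

End OneBlock.

(** * Part (b): comparison of the bounds *)

Section Comparison.
Variables (R : realType) (M : nat).
Hypothesis M2 : (2 <= M)%N.
Local Open Scope ring_scope.
Local Notation eps := (eps R M).
Local Notation theta := (theta R M).
Local Notation rate := (rate R M).

Lemma exprD_ge (x e : R) n : 0 <= x -> 0 <= e ->
  x ^+ n + n%:R * x ^+ n.-1 * e <= (x + e) ^+ n.
Proof.
move=> x0 e0; elim: n => [|n IH]; first by rewrite !expr0 !mul0r addr0.
have xn : 0 <= x ^+ n by rewrite exprn_ge0.
have xn1 : 0 <= n%:R * x ^+ n.-1 by rewrite mulr_ge0 ?exprn_ge0.
have -> : n.+1%:R * x ^+ n.+1.-1 = x ^+ n + n%:R * x ^+ n.-1 * x.
  by case: n {IH xn xn1} => [|n] /=; rewrite ?exprS -?(natr1 n.+1) ?expr0; lra.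
rewrite [leRHS]exprSr exprSr.
apply: le_trans (ler_wpM2r _ IH); last exact: addr_ge0.
have := mulr_ge0 xn1 (mulr_ge0 e0 e0); lra.
Qed.

Lemma exprB_ge (e : R) n : 0 <= e -> e <= 1 -> 1 - n%:R * e <= (1 - e) ^+ n.
Proof.
move=> e0 e1; elim: n => [|n IH]; first by rewrite mul0r subr0.
have h : 0 <= 1 - e by lra.
have := ler_wpM2r h IH; rewrite -exprSr -(natr1 n).
by have := ler0n R n; nra.
Qed.

Lemma rate_le1 : rate <= 1.
Proof. by apply: le_trans (rate_le R M2) _; rewrite gerBl mulr_ge0 ?sqr_ge0. Qed.

Lemma sqr_le_expn n : (n * n + 2 <= 2 ^ n + n)%N || (n == 0)%N.
Proof. by elim: n => [//|[//|[//|n]] /orP[|//]]; rewrite !expnS; lia. Qed.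

Lemma sqr_eps_le : (M%:R ^+ 2 - M%:R + 2) * eps <= 1.
Proof.
have /orP[h|/eqP M0] := sqr_le_expn M; last by move: M2; rewrite M0.
rewrite -[leRHS](eps_nat R M) mulrC ler_wpM2l ?(ltW (eps_gt0 _ _)) //.
by move: h; rewrite -(ler_nat R) !natrD natrM; lra.
Qed.

(** Expand [rate ^ (p + q)] around [theta] to first order, by [exprD_ge]. As [theta * (rate - theta)
    = eps * (1 - (M + 1) * eps)], the hypothesis compares the first-order terms. *)
Lemma block_bound_le p q : (0 < p)%N ->
  p%:R * (M%:R / 2 - 1 + eps) <= (p + q)%:R * (1 - M.+1%:R * eps) ->
  theta ^+ (p + q.+1) + p%:R * theta ^+ (p.-1 + q) *
    (eps * (M%:R - 2 + 2 * eps) / 2) <= theta * rate ^+ (p + q).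
Proof.
case: p => // p _ h.
have e0 := eps_gt0 R M; have t0 := theta_gt0 R M2.
have r0 : 0 <= rate - theta by rewrite subr_ge0 theta_le_rate.
have := exprD_ge (p.+1 + q) (ltW t0) r0; rewrite [theta + _]addrC subrK.
move=> /(ler_wpM2l (ltW t0)); apply: le_trans.
rewrite !addSn !addnS /= [leRHS]mulrDr -exprS lerD2l.
have -> : theta * ((p + q).+1%:R * theta ^+ (p + q) * (rate - theta)) =
  theta ^+ (p + q) * ((p + q).+1%:R * (theta * rate - theta * theta)) by ring.
have -> : p.+1%:R * theta ^+ (p + q) * (eps * (M%:R - 2 + 2 * eps) / 2) =
  theta ^+ (p + q) * (eps * (p.+1%:R * (M%:R / 2 - 1 + eps))) by field.
rewrite ler_wpM2l ?exprn_ge0 ?(ltW t0) // theta_rate //.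
apply: le_trans (ler_wpM2l (ltW e0) h) _.
by rewrite -(natr1 M) addSn /theta; lra.
Qed.

(** Bernoulli's inequality gives [theta <= rate ^ t] as soon as [(t * M + 1) * eps <= 1]. *)
Lemma prefix_bound_le t p n : (t * M < 2 ^ M)%N -> (n <= t * p)%N ->
  theta ^+ p <= rate ^+ n.
Proof.
move=> tM np; have e0 := eps_gt0 R M; have t0 := theta_gt0 R M2.
apply: (@le_trans _ _ (rate ^+ (t * p))); last first.
  apply: ler_wiXn2l np; [exact: rate_ge0|exact: rate_le1].
rewrite exprM; apply: lerXn2r; rewrite ?nnegrE ?exprn_ge0 ?(ltW t0) ?rate_ge0 //.
apply: le_trans (exprB_ge t _ _); last 2 first.
- by rewrite divr_ge0 ?(ltW t0) // mulr_ge0 ?ler0n ?sqr_ge0.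
- by have := rate_ge0 R M2; rewrite subr_ge0.
rewrite lerB // -(ler_pM2l t0).
have -> : theta * (t%:R * (M%:R * eps ^+ 2 / theta)) = t%:R * M%:R * eps * eps.
  by field; rewrite gt_eqF.
rewrite ler_pM2r // -natrM.
by have := eps_le R tM; rewrite -natr1 /theta; lra.
Qed.

Lemma small_eps : M%:R * eps <= 1 / 2.
Proof.
have : (M.*2 <= 2 ^ M)%N.
  by have /orP[|/eqP M0] := sqr_le_expn M; [nia|move: M2; rewrite M0].
by move=> /(eps_le R); rewrite -muln2 natrM; lra.
Qed.

Lemma block_margin t p n : (2 ^ M <= t.+1 * M)%N -> (t * p.+1 < n)%N ->
  p.+2%:R * (M%:R / 2 - 1 + eps) <= n%:R * (1 - M.+1%:R * eps).
Proof.
move=> tM pn; have e0 := eps_gt0 R M; have := small_eps; have := sqr_eps_le.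
have M2R : 2 <= M%:R :> R by rewrite (ler_nat R 2).
have te : 1 <= t.+1%:R * (M%:R * eps).
  rewrite mulrA -natrM mulrC -[leLHS](eps_nat R M) ler_pM2l //.
  by rewrite ler_nat.
have t1 : 1 <= t%:R :> R.
  rewrite (ler_nat R 1); case: t tM {pn te} => // tM.
  by have := ltn_expl M (ltnSn 1); lia.
have nR : t%:R * p.+1%:R + 1 <= n%:R :> R.
  by rewrite -natrM natr1 ler_nat.
rewrite -(natr1 p.+1) -(natr1 p) -(natr1 M) in nR *.
rewrite -natr1 in te.
have := ler0n R p.
move: (p%:R) (n%:R) (t%:R) (M%:R) (eps) e0 M2R te t1 nR => P N T m e e0 m2 te t1 nR P0 sq sm.
set c := 1 - (m + 1) * e; set k := m / 2 - 1 + e.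
have k0 : 0 <= k by rewrite /k; lra.
(* This combines [sqr_eps_le] with [small_eps]; by [te], multiplying it by [T + 1] then removes the
   factor [m * e]. *)
have ck : 2 * k * (m * e) <= c.
  rewrite /c /k; have : 2 * (m * e) * e <= e by rewrite ler_piMl ?(ltW e0) //; lra.
  by move: sq; rewrite expr2; lra.
have me0 : 0 <= m * e by rewrite mulr_ge0; lra.
have c0 : 0 <= c by apply: le_trans ck; rewrite mulr_ge0 // mulr_ge0.
have tc : 2 * k <= (T + 1) * c.
  apply: le_trans (_ : (T + 1) * (2 * k * (m * e)) <= _); last first.
    by rewrite ler_wpM2l //; lra.
  have -> : (T + 1) * (2 * k * (m * e)) = 2 * k * ((T + 1) * (m * e)) by ring.
  by rewrite ler_peMr // mulr_ge0.
have tc' : k <= T * c.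
  by have : 0 <= (T - 1) * c by [apply: mulr_ge0; lra]; lra.
(* Adding [P * k <= P * T * c] and [2 * k <= (T + 1) * c] gives the claim, since
   [T * (P + 1) + 1 <= N]. *)
have := ler_wpM2r c0 nR; have := ler_wpM2l P0 tc'; lra.
Qed.

Lemma switch_margin q : (M + 2 <= q.+1.*2)%N ->
  1%:R * (M%:R / 2 - 1 + eps) <= (1 + q)%:R * (1 - M.+1%:R * eps).
Proof.
move=> qM; have e0 := eps_gt0 R M; have := small_eps; have := sqr_eps_le.
have M2R : 2 <= M%:R :> R by rewrite (ler_nat R 2).
have qR : M%:R + 2 <= 2 * (1 + q)%:R :> R.
  by rewrite -[leRHS]natrM -[leLHS](natrD R M 2) ler_nat mul2n.
rewrite -(natr1 M) mul1r.
move: ((1 + q)%:R) (M%:R) (eps) e0 M2R qR => Q m e e0 m2 qR sq sm.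
have c0 : 0 <= 1 - (m + 1) * e by nra.
have := ler_wpM2r c0 qR.
(* It remains to show [(m ^ 2 + 3 * m + 4) * e <= 4]; this product is the slack against four times
   [sqr_eps_le]. *)
have : 0 <= (3 * m - 4) * (m - 1) * e by rewrite !mulr_ge0 //; lra.
move: sq; rewrite expr2; lra.
Qed.

Lemma Pr_block_le_altword p q :
  Pr R (seen M (nseq p true ++ nseq q false)) <=
  Pr R (seen M (altword true (p + q))).
Proof.
have t0 := theta_gt0 R M2; have e0 := eps_gt0 R M.
have r0 := rate_ge0 R M2.
have M0 : (0 < M)%N by lia.
have tr n : theta ^+ n <= rate ^+ n.
  by apply: lerXn2r (theta_le_rate R M2); rewrite nnegrE // ltW.
have constant b n : Pr R (seen M (nseq n.+1 b)) <= Pr R (seen M (altword true n.+1)).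
  apply: le_trans (Pr_alternating_ge R M2 true n).
  have := Pr_const_prefix_le R M b n.+1 [::]; rewrite cats0 => /le_trans; apply.
  by rewrite exprS ler_wpM2l ?tr ?(ltW t0).
case: q => [|q]; first by case: p => [//|p]; rewrite cats0 addn0.
case: p => [|p]; first exact: constant.
(* The excluded word is one [1] and one [0], which is itself alternating. *)
have [/andP[/eqP -> /eqP ->] //|pq] := boolP ((p == 0)%N && (q == 0)%N).
rewrite addnS; apply: le_trans (Pr_alternating_ge R M2 true (p.+1 + q)).
(* The largest [t] with [t * M < 2 ^ M]; it decides between [prefix_bound_le] and [block_margin]. *)
pose t := ((2 ^ M).-1 %/ M)%N.
have block := Pr_block_le R true false p.+1 q M0.
case: p pq block => [|p] pq block.
  have [/switch_margin h|] := leqP (M + 2) q.+1.*2.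
    exact: le_trans block (block_bound_le _ h).
  case: q {block} pq => [//|q] _ qM.
  have -> : nseq q.+2 false = [:: false; false] ++ nseq q false by [].
  rewrite catA; apply: le_trans (_ : _ <= Pr R (seen M [:: true; false; false])) _.
    by apply: Pr_le => [||y]; [exact: local_seen..|exact: seen_catl].
  apply: le_trans (Pr_switch_twice_le R M true) _.
  have e1 : 0 <= M%:R * eps ^+ 2 / theta by rewrite divr_ge0 ?(ltW t0) // mulr_ge0 ?ler0n ?sqr_ge0.
  have := exprB_ge (1 + q.+1) e1 ltac:(by rewrite -subr_ge0; exact: r0).
  move=> /(ler_wpM2l (ltW t0)); apply: le_trans.
  have -> : theta * (1 - (1 + q.+1)%:R * (M%:R * eps ^+ 2 / theta)) =
    theta - (1 + q.+1)%:R * (M%:R * eps ^+ 2) by field; rewrite gt_eqF.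
  (* So the Bernoulli loss for the alternating word is at most [M * (M + 1) / 2 * eps ^ 2], the last
     term of [Pr_switch_twice_le]. *)
  have qR : 2 * (1 + q.+1)%:R <= M.+1%:R :> R.
    by rewrite -natrM ler_nat; lia.
  have : 0 <= M%:R * eps ^+ 2 * (M.+1%:R - 2 * (1 + q.+1)%:R).
    by rewrite mulr_ge0 ?subr_ge0 // mulr_ge0 ?ler0n ?sqr_ge0.
  by rewrite /theta; lra.
have tM : (t * M < 2 ^ M)%N.
  by have := leq_divM (2 ^ M).-1 M; have := expn_gt0 2 M; rewrite -/t; lia.
have tM' : (2 ^ M <= t.+1 * M)%N.
  by have := ltn_ceil (2 ^ M).-1 M0; have := expn_gt0 2 M; rewrite -/t; lia.
have [nt|tn] := leqP (p.+2 + q) (t * p.+1).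
  apply: le_trans (Pr_const_prefix_le R M true p.+2 _) _.
  by rewrite exprS ler_wpM2l ?(ltW t0) //; exact: prefix_bound_le tM nt.
exact: le_trans block (block_bound_le _ (block_margin tM' tn)).
Qed.

End Comparison.

Theorem theorem1 (d : measure_display) (T : measurableType d) (R : realType)
    (P : probability T R) (Y : nat -> {RV P >-> bool})
    (hY : iid_fair_bits Y) :
  (forall (n : nat) (W : n.-tuple bool), (1 <= n)%N ->
     (prob_seen Y 2 W <= v Y 2 n)%E) /\
  (forall M p q : nat, (2 <= M)%N ->
     (prob_seen Y M (block_word p q) <= v Y M (p + q)%N)%E).
Proof.
split=> [n W _|M p q M2]; rewrite /v !(prob_seenE hY) lee_fin.
  by have := Pr_seen2_max R W; rewrite size_tuple.
exact: Pr_block_le_altword.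
Qed.
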